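(* Let $t\geq 2$ be an integer. Then for all integers $n\geq 0$, $$\bar{B}_{3,2^t}(16n+6)\equiv 0 \pmod 8,\qquad \bar{B}_{3,2^t}(16n+10)\equiv 0 \pmod 8,\qquad \bar{B}_{3,2^t}(16n+14)\equiv 0 \pmod 8.$$
   Context: An overpartition of a positive integer $n$ is a partition of $n$ in which the first occurrence of each distinct part may be overlined. For coprime integers $\ell_1,\ell_2>1$, $\bar{B}_{\ell_1,\ell_2}(n)$ denotes the number of overpartitions of $n$ in which no part is divisible by $\ell_1$ or by $\ell_2$, with $\bar{B}_{\ell_1,\ell_2}(0)=1$. *)

(* Defs.v *)
From mathcomp Require Import all_boot.

Set Implicit Arguments.
Unset Strict Implicit.
Unset Printing Implicit Defensive.

(* A sequence of flagged integers is read as a list of parts in nonincreasing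
   order, where the flag [true] means that this occurrence is overlined.  *)
Definition overpartition (n : nat) (s : seq (nat * bool)) : bool :=
  [&& sorted geq (unzip1 s),
      all (fun x => 0 < x) (unzip1 s),
      sumn (unzip1 s) == n
    & [forall i : 'I_(size s),
         nth false (unzip2 s) i ==>
         (nth 0 (unzip1 s) i \notin take i (unzip1 s))]].

Definition regular_parts (l1 l2 : nat) (s : seq (nat * bool)) : bool :=
  all (fun x => ~~ (l1 %| x) && ~~ (l2 %| x)) (unzip1 s).

(* An overpartition of [n] has at most [n] parts, each at most [n]
   (see [overpartition_bounded]), so the overpartitions of [n] are exactly the
   images of the elements of the finite type [{bseq n of 'I_n.+1 * bool}].  *)
Definition forget_bound (n : nat) (s : {bseq n of 'I_n.+1 * bool}) :
    seq (nat * bool) :=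
  [seq (val x.1, x.2) | x <- s].

Definition Bbar (l1 l2 n : nat) : nat :=
  #|[set s : {bseq n of 'I_n.+1 * bool} |
      overpartition n (forget_bound s) && regular_parts l1 l2 (forget_bound s)]|.

Lemma forget_bound_inj n : injective (@forget_bound n).
Proof.
move=> s1 s2 /inj_map e; apply: val_inj; apply: e => -[a b] [c d] /= [eac ->].
by congr (_, _); apply: val_inj.
Qed.

Lemma overpartition_bounded n s :
  overpartition n s -> exists u : {bseq n of 'I_n.+1 * bool}, forget_bound u = s.
Proof.
case/and4P=> _ pos /eqP sum_s _.
have le_size : size s <= n.
  rewrite -sum_s; elim: s {sum_s} pos => //= -[a b] s IH /= /andP[a0 /IH].
  by rewrite -addn1 addnC => h; apply: leq_add.
have le_part x : x \in s -> x.1 <= n.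
  rewrite -sum_s; elim: s {sum_s pos le_size} => //= y s IH.
  rewrite inE => /predU1P[->|/IH h]; first exact: leq_addr.
  exact: leq_trans h (leq_addl _ _).
pose g (x : nat * bool) : 'I_n.+1 * bool := (inord x.1, x.2).
have sz : size (map g s) <= n by rewrite size_map.
exists (Bseq sz); rewrite /forget_bound /= -map_comp -[RHS]map_id.
by apply/eq_in_map => -[a b] /le_part /= an; rewrite inordK.
Qed.

Lemma Bbar0 l1 l2 : Bbar l1 l2 0 = 1.
Proof.
have nil0 (s : {bseq 0 of 'I_1 * bool}) : s = [bseq] by case: s => -[|//] ?; apply: val_inj.
apply/eqP/cards1P; exists [bseq]; apply/setP=> s; rewrite !inE (nil0 s) eqxx.
by apply/andP; split=> //; apply/and4P; split=> //; apply/forallP; case.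
Qed.

(* Main.v *)
(** A partition with [r] distinct part sizes carries [2 ^ r] overpartitions, so
    modulo 8 the count of overpartitions of [n > 0] is [2 N1 + 4 N2], where [Nr]
    counts the partitions with exactly [r] part sizes.  Let [n = 2 m] with [m]
    odd, and let [tau k] be the number of allowed divisors of [k].  Then
    [N1 = 2 tau m], and [N2] is governed by the convolution of [tau] with itself
    at [n].  Modulo 2 only the terms with both [tau k] and [tau (n - k)] odd
    survive; they come from writing [2 m] or [2 m / 3] as a sum of two odd
    squares.  For [M] odd, Zagier's windmill involution shows that the number of
    [k < M] with [k] and [2 M - k] squares has the parity of
    [#{d | M, d^2 < M} + #{d | M, M/d = 3 mod 4}].  With these values everything
    cancels as soon as [m] is not a square, which holds when [m] is 3, 5 or 7
    modulo 8. *)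

From Stdlib Require Import PeanoNat.
Require Import Defs.
From mathcomp Require Import all_boot zify.

Set Implicit Arguments.
Unset Strict Implicit.
Unset Printing Implicit Defensive.

(** * Enumeration of overpartitions *)

(* With starting value [(p, false)], paths for [follows] are the overpartitions
   with parts at most [p] in which [p] itself is not overlined. *)
Definition follows (y x : nat * bool) := (x.1 <= y.1) && (x.2 ==> (x.1 < y.1)).

(** In a nonincreasing list a part not exceeding the last one occurs earlier only if it equals the
    last one, so comparing with the last entry decides whether [x] is a first occurrence. *)
Lemma follows_last p s x :
  sorted geq (unzip1 s) -> all (fun a => a < p) (unzip1 s) -> x.1 < p ->
  follows (last (p, false) s) x =
    sorted geq (unzip1 (rcons s x)) && (x.2 ==> (x.1 \notin unzip1 s)).
Proof.
case: s => [|y s] /=; first by case: x => a [] _ _ h; rewrite /follows /= ltnW // h.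
move=> ys _ _; rewrite /follows /unzip1 map_rcons rcons_path -/(unzip1 s) ys /= last_map.
have le_last : all (geq^~ (last y s).1) (y.1 :: unzip1 s).
  elim: (s) (y) ys => [|z s' IH] z' /=; first by rewrite leqnn.
  case/andP=> zz' /IH /= /andP[h ->]; rewrite h (leq_trans h zz') //.
have last_in : (last y s).1 \in y.1 :: unzip1 s by rewrite -last_map mem_last.
case: ltngtP => //= [lt_x|->]; last by rewrite last_in.
case: x.2 => //=; apply/esym/negP=> /(allP le_last) /=.
by rewrite leqNgt lt_x.
Qed.

(** Appending an entry leaves the conditions at earlier positions unchanged and adds one more, so
    the global first-occurrence rule becomes a rule on neighbours. *)
Lemma follows_path p s : all (fun a => a < p) (unzip1 s) ->
  path follows (p, false) s =
    sorted geq (unzip1 s) &&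
    [forall i : 'I_(size s), nth false (unzip2 s) i ==>
         (nth 0 (unzip1 s) i \notin take i (unzip1 s))].
Proof.
have forallE (k : nat) (P : pred nat) : [forall i : 'I_k, P i] = all P (iota 0 k).
  apply/forallP/allP => [h i|h i]; last by apply: h; rewrite mem_iota /=.
  by rewrite mem_iota => /= hi; apply: (h (Ordinal hi)).
pose Q s (i : nat) := nth false (unzip2 s) i ==>
         (nth 0 (unzip1 s) i \notin take i (unzip1 s)).
rewrite (forallE _ (Q s)).
elim/last_ind: s => [|s x IH] //.
rewrite {1}/unzip1 map_rcons all_rcons => /andP[xp sp].
rewrite rcons_path IH // size_rcons -addn1 iotaD all_cat /= andbT add0n.
have -> : all (Q (rcons s x)) (iota 0 (size s)) = all (Q s) (iota 0 (size s)).
  apply/eq_in_all => i; rewrite mem_iota /= => hi.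
  rewrite /Q /unzip1 /unzip2 !map_rcons !nth_rcons !size_map hi.
  by rewrite -cats1 takel_cat // size_map ltnW.
have -> : Q (rcons s x) (size s) = x.2 ==> (x.1 \notin unzip1 s).
  rewrite /Q /unzip1 /unzip2 !map_rcons !nth_rcons !size_map ltnn eqxx.
  by rewrite -cats1 takel_cat ?size_map // take_oversize ?size_map.
case sorts: (sorted geq (unzip1 s)); last first.
  rewrite /=; apply/esym/negbTE; rewrite negb_and; apply/orP; left; apply/negP.
  rewrite /unzip1 map_rcons -cats1 => /(cat_sorted2)[].
  by rewrite -/(unzip1 s) sorts.
by rewrite (follows_last sorts sp xp) /= andbCA.
Qed.

(** * Generating function and recursive enumeration, by bound on the parts *)

Section Count.

Variable A : pred nat.
Hypothesis A0 : ~~ A 0.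

Definition valid_below p n s :=
  [&& path follows (p, false) s, all A (unzip1 s) & sumn (unzip1 s) == n].

(** Here [k] stands for the total of at least one copy of the part [a]. *)
Definition pos_dvd (a k : nat) : nat := (0 < k) && (a %| k).

(* Coefficients of the product of [(1 + q^a) / (1 - q^a)] over [a < p] with [A a]. *)
Fixpoint count_below p n : nat :=
  if p is q.+1 then
    count_below q n + A q * (2 * \sum_(k < n.+1) pos_dvd q k * count_below q (n - k))
  else n == 0.

Definition count_multiples p n := \sum_(k < n.+1) pos_dvd p k * count_below p (n - k).

(* The extra factor is [1 / (1 - q^p)], since [p] may not be overlined. *)
Definition count_upto p n := count_below p n + A p * count_multiples p n.

Lemma count_multiples_rec p n : 0 < p -> count_multiples p n =
  if p <= n then count_below p (n - p) + count_multiples p (n - p) else 0.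
Proof.
move=> p0; rewrite /count_multiples; case: leqP => [le_pn|lt_np]; last first.
  rewrite big1 // => k _; rewrite /pos_dvd; case: (posnP k) => //= k0.
  by rewrite gtnNdvd //; have := ltn_ord k; lia.
rewrite -(big_mkord xpredT (fun k => pos_dvd p k * count_below p (n - k))).
rewrite (big_cat_nat (n := p)) //=; last by lia.
rewrite [X in X + _]big_nat_cond big1; last first.
  move=> k /andP[/andP[_ kp] _]; rewrite /pos_dvd; case: (posnP k) => //= k0.
  by rewrite gtnNdvd.
rewrite add0n -{1}[p]add0n big_addn subSn // big_nat_recl // big_mkord add0n.
rewrite {1}/pos_dvd p0 dvdnn mul1n; congr (_ + _).
rewrite -(big_mkord xpredT (fun k => pos_dvd p k * count_below p (n - p - k))) big_nat_recl //.
rewrite {2}/pos_dvd /= mul0n add0n.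
rewrite big_mkord; apply: eq_bigr => k _.
have -> : n - (k.+1 + p) = n - p - k.+1 by lia.
by rewrite /pos_dvd dvdn_addl // addSn.
Qed.

(** For allowed parts, [count_below p.+1] arises from [count_upto p] through the factor 1 + q^p, and
    [count_upto p.+1] from that through 1 / (1 - q^(p+1)). The three terms mirror the three cases of
    [valid_cons]. *)
Lemma count_upto_rec p n : count_upto p.+1 n =
  count_upto p n + (A p && (p <= n)) * count_upto p (n - p)
  + (A p.+1 && (p < n)) * count_upto p.+1 (n - p.+1).
Proof.
have CE : count_below p.+1 n = count_upto p n + (A p && (p <= n)) * count_upto p (n - p).
  rewrite /count_upto /= -/(count_multiples p n) -addnA; congr (_ + _).
  case Ap: (A p) => //=; rewrite !mul1n.
  have p0: 0 < p by case: (p) Ap A0 => // ->.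
  by rewrite count_multiples_rec //; case: leqP; lia.
rewrite {1}/count_upto CE; congr (_ + _).
case Ap: (A p.+1) => //=; rewrite mul1n count_multiples_rec // /count_upto Ap !mul1n.
by case: ltnP; lia.
Qed.

(** Raising the bound from [p] to [p.+1] admits only two new first entries: an overlined [p] and a
    plain [p.+1]. *)
Lemma valid_cons p n x s : valid_below p.+1 n (x :: s) =
  [|| valid_below p n (x :: s),
      [&& x == (p, true), A p, p <= n & valid_below p (n - p) s] |
      [&& x == (p.+1, false), A p.+1, p < n & valid_below p.+1 (n - p.+1) s]].
Proof.
(* [follows] reads only the size of the previous entry, so its overline does not constrain the
   tail. *)
have pathE y b : path follows (y, b) s = path follows (y, false) s by case: s.
case: x => a b; rewrite /valid_below /= (pathE a b).
have followsE q : follows (q, false) (a, b) = (a <= q) && (b ==> (a < q)) by [].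
rewrite !followsE !xpair_eqE.
have [lt_ap|lt_pa|->] := ltngtP a p.
- have -> : a <= p.+1 by lia.
  have -> : a < p.+1 by lia.
  have -> : (a == p.+1) = false by lia.
  by rewrite !orbF.
- have [|lt_pa'|->] := ltngtP a p.+1; [lia|by []|] => /=.
  case: b {followsE} => //=; case Ap: (A p.+1) => /=; last by rewrite andbF.
  case: ltnP => le_pn; last first.
    by rewrite (_ : _ == n = false) ?andbF //; lia.
  by congr [&& _, _ & _]; lia.
- rewrite leqnSn ltnSn implybT (_ : (p == p.+1) = false); last by lia.
  case: b {followsE} => /=; rewrite ?orbF //.
  case Ap: (A p) => /=; last by rewrite andbF.
  case: leqP => le_pn; last first.
    by rewrite (_ : _ == n = false) ?andbF //; lia.
  by congr [&& _, _ & _]; lia.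
Qed.

(** The inner induction on [n] is there because a plain [p.+1] may be repeated: removing it lowers
    [n] but keeps the bound. *)
Lemma enum_valid p n :
  exists l, [/\ uniq l, forall s, (s \in l) = valid_below p n s & size l = count_upto p n].
Proof.
elim: p n => [|p IHp] n.
  exists (nseq (n == 0) [::]); split.
  - by case: eqP.
  - move=> s; rewrite mem_nseq lt0b /valid_below; case: s => [|[[|a] b] s] /=.
    + by rewrite eq_sym andbT.
    + by rewrite (negbTE A0) /= !andbF.
    + by rewrite !andbF.
  - by rewrite size_nseq /count_upto (negbTE A0) mul0n addn0.
elim/ltn_ind: n => n IHn.
have [l1 [u1 m1 s1]] := IHp n.
have [l2 [u2 m2 s2]] := IHp (n - p).
have [l3 [u3 m3 s3]] : exists l, [/\ uniq l,
     forall s, (s \in l) = (A p.+1 && (p < n)) && valid_below p.+1 (n - p.+1) s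
   & size l = (A p.+1 && (p < n)) * count_upto p.+1 (n - p.+1)].
  case: (boolP (A p.+1 && (p < n))) => [/andP[_ pn]|_]; last by exists [::].
  have [|l [u m s]] := IHn (n - p.+1); first by lia.
  by exists l; rewrite mul1n.
pose l2' := if A p && (p <= n) then l2 else [::].
have u2' : uniq l2' by rewrite /l2'; case: ifP.
have m2' s : (s \in l2') = (A p && (p <= n)) && valid_below p (n - p) s.
  by rewrite /l2'; case: ifP => _; rewrite ?m2.
have s2' : size l2' = (A p && (p <= n)) * count_upto p (n - p).
  by rewrite /l2'; case: ifP => _; rewrite ?s2 ?mul1n.
have consI (x : nat * bool) : injective (cons x) by move=> ? ? [].
have memc x (l : seq (seq (nat * bool))) s :
    (s \in map (cons x) l) = if s is y :: s' then (y == x) && (s' \in l) else false.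
  apply/mapP/idP => [[s' ls ->]|]; first by rewrite eqxx.
  by case: s => // y s /andP[/eqP -> ls]; exists s.
exists (l1 ++ map (cons (p, true)) l2' ++ map (cons (p.+1, false)) l3); split.
- rewrite !cat_uniq u1 !map_inj_uniq // u2' u3 /= andbT.
  apply/andP; split; apply/hasPn => s; rewrite ?mem_cat !memc.
    case: s => // y s; rewrite m1 /valid_below /= => /orP[] /andP[/eqP -> _] /=.
      by rewrite /follows /= ltnn andbF.
    by rewrite /follows /= ltnn.
  by case: s => // y s /andP[/eqP -> _]; rewrite xpair_eqE andbF.
- move=> s; rewrite !mem_cat !memc m1.
  case: s => [|x s]; first by rewrite /valid_below /= orbF.
  by rewrite m2' m3 valid_cons !andbA.
- by rewrite !size_cat !size_map s1 s2' s3 [RHS]count_upto_rec // addnA.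
Qed.

End Count.

Definition regular_part l1 l2 x := ~~ (l1 %| x) && ~~ (l2 %| x).

Lemma Bbar_count l1 l2 n : Bbar l1 l2 n = count_below (regular_part l1 l2) n.+1 n.
Proof.
have A0 : ~~ regular_part l1 l2 0 by rewrite /regular_part dvdn0.
have [l [ul ml sl]] := enum_valid A0 n.+1 n.
have -> : count_below (regular_part l1 l2) n.+1 n = size l.
  (* A part [n.+1] exceeds the total [n], so at this bound the extra factor of [count_upto]
     contributes nothing. *)
  have D0 : count_multiples (regular_part l1 l2) n.+1 n = 0 by rewrite count_multiples_rec // ltnn.
  by rewrite sl /count_upto D0 muln0 addn0.
rewrite /Bbar cardE -(size_map (@forget_bound n)).
apply/perm_size/uniq_perm => //.
  by rewrite (map_inj_uniq (@forget_bound_inj n)) enum_uniq.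
have main s : overpartition n s && regular_parts l1 l2 s =
    valid_below (regular_part l1 l2) n.+1 n s.
  rewrite /overpartition /regular_parts /valid_below.
  rewrite -[all (fun x => _ && _) _]/(all (regular_part l1 l2) (unzip1 s)).
  case regs: (all (regular_part l1 l2) (unzip1 s)); last by rewrite !andbF.
  have -> : all (fun x => 0 < x) (unzip1 s).
    by apply: sub_all regs => -[|x] //; rewrite (negbTE A0).
  case: eqP => sums; rewrite ?andbF //= ?andbT.
  rewrite follows_path //; apply/allP => x xs; rewrite ltnS -sums.
  elim: (unzip1 s) xs => //= y r IH; rewrite inE => /predU1P[->|/IH]; lia.
move=> s; rewrite ml -main; apply/mapP/idP => [[u]|h].
  by rewrite mem_enum inE => ? ->.
have [u uE] := overpartition_bounded (proj1 (andP h)).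
by exists u; rewrite ?mem_enum ?inE ?uE.
Qed.

(** * Sums of two squares modulo 2 *)

(** Removing a two-element orbit [x], [f x] changes neither parity; induction leaves the fixed
    points. *)
Lemma odd_size_involution (T : eqType) (s : seq T) (f : T -> T) :
  uniq s -> {in s, forall x, f x \in s} -> {in s, forall x, f (f x) = x} ->
  odd (size s) = odd (count (fun x => f x == x) s).
Proof.
have [k] := ubnP (size s); elim: k s => // k IH [|x s] //= szs /andP[xs us] fs ffs.
case: eqP => [fx|/eqP fx].
  have h y : y \in s -> f y \in s.
    move=> ys; have := fs y; rewrite !inE ys orbT => /(_ isT) /predU1P[fy|//].
    by move: xs; rewrite -fx -fy ffs ?ys // inE ys orbT.
  by rewrite (IH s) // => y ys; apply: ffs; rewrite inE ys orbT.
have fxs : f x \in s by have := fs x; rewrite !inE eqxx (negbTE fx) => /(_ isT).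
have sE : perm_eq s (f x :: rem (f x) s) by apply: perm_to_rem.
have ffx : f (f x) = x by apply: ffs; rewrite inE eqxx.
rewrite (perm_size sE) (permP sE) /= ffx eq_sym (negbTE fx) !add0n negbK.
have rs y : y \in rem (f x) s -> [/\ y \in s, y != f x & y != x].
  by rewrite mem_rem_uniq // => /andP[/= h ys]; split => //; apply: contra xs => /eqP <-.
apply: IH; first by rewrite size_rem //; case: (s) szs fxs => //= *; lia.
- exact: rem_uniq.
- move=> y /rs[ys yfx yx]; rewrite mem_rem_uniq // inE /=.
  have ysx : y \in x :: s by rewrite inE ys orbT.
  have ffy := ffs _ ysx.
  apply/andP; split; first by apply: contra yx => /eqP e; rewrite -ffy e ffx.
  have := fs _ ysx; rewrite inE => /predU1P[e|//].
  by move: yfx; rewrite -ffy e eqxx.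
- by move=> y /rs[ys _ _]; apply: ffs; rewrite inE ys orbT.
Qed.

Lemma size_bijection (T U : eqType) (s : seq T) (r : seq U) (f : T -> U) (g : U -> T) :
  uniq s -> uniq r ->
  (forall x, x \in s -> f x \in r /\ g (f x) = x) ->
  (forall y, y \in r -> g y \in s /\ f (g y) = y) -> size s = size r.
Proof.
move=> us ur fP gP; apply/eqP; rewrite eqn_leq; apply/andP; split.
  rewrite -(size_map f); apply: uniq_leq_size => [|_ /mapP[x /fP[? _] ->] //].
  by rewrite map_inj_in_uniq // => x y /fP[_ {2}<-] /fP[_ {2}<-] ->.
rewrite -(size_map g); apply: uniq_leq_size => [|_ /mapP[x /gP[? _] ->] //].
by rewrite map_inj_in_uniq // => x y /gP[_ {2}<-] /gP[_ {2}<-] ->.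
Qed.

Lemma count_none (T : eqType) (a : pred T) (s : seq T) :
  {in s, forall x, ~~ a x} -> count a s = 0.
Proof. by move=> h; apply/eqP; rewrite -leqn0 leqNgt -has_count; apply/hasPn. Qed.

(** * Parities of divisor counts from the pairing of d with M / d *)

Definition is_square k := Nat.sqrt k * Nat.sqrt k == k.

Lemma is_squareP k : reflect (exists w, w * w = k) (is_square k).
Proof.
apply: (iffP eqP) => [|[w <-]]; first by exists (Nat.sqrt k).
by rewrite -!multE Nat.sqrt_square.
Qed.

Definition ndiv M := size (divisors M).
Definition nsmall_div M := count (fun d => d * d < M) (divisors M).
Definition nco3_div M := count (fun d => (M %/ d) %% 4 == 3) (divisors M).
(** The range [k < M] lists each way of writing 2M as a sum of two distinct squares once, smaller
    square first. *)
Definition nsq_pairs M := count (fun k => is_square k && is_square (2 * M - k)) (iota 0 M).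

Lemma mem_divisors M d : 0 < M -> (d \in divisors M) = (d %| M).
Proof. by move=> M0; rewrite dvdn_divisors. Qed.

Lemma divisor_flip M d : 0 < M -> d %| M ->
  [/\ M %/ d %| M, M %/ (M %/ d) = d, 0 < d & d * (M %/ d) = M].
Proof.
move=> M0 dM; have d0 := dvdn_gt0 M0 dM.
have E : d * (M %/ d) = M by rewrite mulnC divnK.
split=> //; first by rewrite -{2}E dvdn_mull.
by rewrite divnA // mulKn.
Qed.

Lemma ndiv_nsmall M : 0 < M -> ndiv M = 2 * nsmall_div M + is_square M.
Proof.
move=> M0; rewrite /ndiv.
have -> : size (divisors M) = nsmall_div M + count (fun d => d * d == M) (divisors M)
   + count (fun d => M < d * d) (divisors M).
  rewrite /nsmall_div; elim: (divisors M) => //= d s ->.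
  by case: (ltngtP (d * d) M); lia.
have -> : count (fun d => M < d * d) (divisors M) = nsmall_div M.
  rewrite /nsmall_div -!size_filter.
  apply: (@size_bijection _ _ _ _ (divn M) (divn M));
    rewrite ?filter_uniq ?divisors_uniq // => d; rewrite !mem_filter mem_divisors //.
    case/andP=> lt /(divisor_flip M0)[h -> d0 E]; split=> //.
    by rewrite mem_divisors // h andbT; nia.
  case/andP=> lt /(divisor_flip M0)[h -> d0 E]; split=> //.
  by rewrite mem_divisors // h andbT; nia.
suff -> : count (fun d => d * d == M) (divisors M) = is_square M by lia.
case: is_squareP => [[w wM]|nw].
  rewrite (@eq_count _ _ (pred1 w)); last by move=> d /=; nia.
  by rewrite count_uniq_mem ?divisors_uniq // mem_divisors // -wM dvdn_mulr.
by apply: count_none => d _; apply/eqP => h; apply: nw; exists d.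
Qed.

(** Exactly one of d and M / d is 3 modulo 4, and exactly one is the smaller, so both sides count
    the pairs {d, M / d}. *)
Lemma nco3_div_mod3 M : M %% 4 = 3 -> nco3_div M = nsmall_div M.
Proof.
move=> M3; have M0 : 0 < M by lia.
have res d : d %| M -> d %% 4 = 1 /\ (M %/ d) %% 4 = 3 \/ d %% 4 = 3 /\ (M %/ d) %% 4 = 1.
  case/(divisor_flip M0) => _ _ _ E; have : (d * (M %/ d)) %% 4 = 3 by rewrite E.
  rewrite -modnMm; set a := d %% 4; set b := (M %/ d) %% 4.
  have : a < 4 by apply: ltn_pmod. have : b < 4 by apply: ltn_pmod.
  by case: a => [|[|[|[|]]]] //; case: b => [|[|[|[|]]]] //; auto.
rewrite /nco3_div /nsmall_div -!size_filter.
pose f d := if (M %/ d) < d then M %/ d else d.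
pose g d := if (M %/ d) %% 4 == 3 then d else M %/ d.
apply: (@size_bijection _ _ _ _ f g);
    rewrite ?filter_uniq ?divisors_uniq // => d; rewrite !mem_filter mem_divisors //.
  case/andP=> /eqP h dM; have [dM' e d0 E] := divisor_flip M0 dM.
  have r := res _ dM.
  rewrite /f /g; case: (ltnP (M %/ d) d) => lt; rewrite ?e ?h ?eqxx mem_divisors ?dM ?dM' ?andbT //.
    by split; [nia | rewrite ifF //; lia].
  split=> //; suff : d != M %/ d by nia.
  by apply/eqP => h'; rewrite -h' in h r; lia.
case/andP=> lt dM; have [dM' e d0 E] := divisor_flip M0 dM.
have r := res _ dM; have lt' : d < M %/ d by rewrite -(ltn_pmul2l d0) E.
rewrite /f /g; case: (boolP ((M %/ d) %% 4 == 3)) => h.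
  by rewrite h mem_divisors // dM ltnNge (ltnW lt').
by rewrite e lt' mem_divisors // dM'; split=> //; lia.
Qed.

(** Now d and M / d agree modulo 4, so exchanging them is an involution on the counted divisors,
    with fixed points d^2 = M. *)
Lemma odd_nco3_div M : M %% 4 = 1 ->
  odd (nco3_div M) = odd (count (fun d => (d * d == M) && (d %% 4 == 3)) (divisors M)).
Proof.
move=> M1; have M0 : 0 < M by lia.
have res d : d %| M -> d %% 4 = (M %/ d) %% 4.
  case/(divisor_flip M0) => _ _ _ E; have : (d * (M %/ d)) %% 4 = 1 by rewrite E.
  rewrite -modnMm; set a := d %% 4; set b := (M %/ d) %% 4.
  have : a < 4 by apply: ltn_pmod. have : b < 4 by apply: ltn_pmod.
  by case: a => [|[|[|[|]]]] //; case: b => [|[|[|[|]]]] //; auto.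
rewrite /nco3_div -size_filter (@odd_size_involution _ _ (divn M)).
- rewrite count_filter; congr odd; apply: eq_in_count => d.
  rewrite mem_divisors // => dM /=; rewrite -res //; congr (_ && _).
  by have [_ _ d0 E] := divisor_flip M0 dM; nia.
- by rewrite filter_uniq ?divisors_uniq.
- move=> d; rewrite !mem_filter !mem_divisors // => /andP[h dM].
  by have [-> -> _ _] := divisor_flip M0 dM; rewrite res // h.
- by move=> d; rewrite mem_filter mem_divisors // => /andP[_ /(divisor_flip M0)[]].
Qed.

(** * Windmills: solutions of x^2 + 4yz = M with y and z positive *)

Definition windmills M : seq (nat * (nat * nat)) :=
  [seq p <- [seq (x, q) | x <- iota 0 M.+1,
                q <- [seq (y, z) | y <- iota 0 M.+1, z <- iota 0 M.+1]] |
    [&& p.1 * p.1 + 4 * (p.2.1 * p.2.2) == M, 0 < p.2.1 & 0 < p.2.2]].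

Lemma mem_windmills M x y z :
  ((x, (y, z)) \in windmills M) = [&& x * x + 4 * (y * z) == M, 0 < y & 0 < z].
Proof.
rewrite mem_filter; apply: andb_idr => /and3P[/eqP E y0 z0].
rewrite /= in E y0 z0.
by apply: allpairs_f; rewrite ?allpairs_f // mem_iota; nia.
Qed.

Lemma windmills_uniq M : uniq (windmills M).
Proof.
rewrite filter_uniq //; apply: allpairs_uniq; rewrite ?iota_uniq //.
  by apply: allpairs_uniq; rewrite ?iota_uniq // => -[? ?] [? ?] _ _ [-> ->].
by move=> -[? ?] [? ?] _ _ [-> ->].
Qed.

Lemma odd_windmill M x c : M %% 4 = 1 -> x * x + 4 * c = M -> odd x.
Proof. by move=> M1 E; have : odd (x * x) by [lia]; rewrite oddM andbb. Qed.

(** The fixed points of exchanging y and z satisfy x^2 + (2y)^2 = M, which matches (x - 2y)^2 + (x +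
    2y)^2 = 2M. *)
Lemma windmills_swap M : M %% 4 = 1 -> odd (size (windmills M)) = odd (nsq_pairs M).
Proof.
move=> M1; rewrite (@odd_size_involution _ _ (fun p => (p.1, (p.2.2, p.2.1)))).
- congr odd; rewrite /nsq_pairs -!size_filter.
  (* One of the two truncated differences is 0, so [u] is |x - 2y|. *)
  pose f (p : nat * (nat * nat)) := let u := (p.1 - 2 * p.2.1) + (2 * p.2.1 - p.1) in u * u.
  (* Since a^2 + b^2 = M is odd, exactly one of [a] and [b] is odd: that one is x, the other is
     2y. *)
  pose g k := let u := Nat.sqrt k in let v := Nat.sqrt (2 * M - k) in
    let a := (u + v)./2 in let b := (v - u)./2 in
    if odd a then (a, (b./2, b./2)) else (b, (a./2, a./2)).
  have sqE w : Nat.sqrt (w * w) = w by rewrite -multE Nat.sqrt_square.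
  apply: (@size_bijection _ _ _ _ f g).
  + exact: (filter_uniq _ (windmills_uniq M)).
  + exact: (filter_uniq _ (iota_uniq _ _)).
  + move=> [x [y z]]; rewrite mem_filter mem_windmills !xpair_eqE eqxx /=.
    case/andP=> /andP[/eqP -> _] {z} /and3P[/eqP E y0 _]; rewrite /f /=.
    set u := _ + _; have vE : (x + 2 * y) * (x + 2 * y) = 2 * M - u * u by nia.
    rewrite mem_filter mem_iota /= /is_square -vE !sqE !eqxx /=.
    split; first by nia.
    rewrite /g -vE !sqE.
    have xo : odd x := odd_windmill M1 E.
    have e2 : (2 * y)./2 = y by rewrite mul2n doubleK.
    have o2 : odd (2 * y) = false by rewrite oddM.
    case: (leqP x (2 * y)) => xy.
      have -> : (u + (x + 2 * y))./2 = 2 * y by lia.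
      have -> : (x + 2 * y - u)./2 = x by lia.
      by rewrite o2 e2.
    have -> : (u + (x + 2 * y))./2 = x by lia.
    have -> : (x + 2 * y - u)./2 = 2 * y by lia.
    by rewrite xo e2.
  move=> k; rewrite [k \in _]mem_filter mem_iota add0n.
  move=> /andP[/andP[/is_squareP[u uE] /is_squareP[v vE]] /= kM].
  rewrite /g -vE -uE !sqE.
  have uvM : u * u + v * v = 2 * M by lia.
  have uv : u < v by nia.
  have M_odd : odd M by lia.
  have oddE : odd u = odd v.
    by have : odd (u * u) = odd (v * v) by [lia]; rewrite !oddM !andbb.
  set a := (u + v)./2; set b := (v - u)./2.
  have aE : a = u + b by lia.
  have vab : v = a + b by lia.
  have abM : a * a + b * b = M by nia.
  have oddab : odd a = ~~ odd b.
    by have : odd (a * a) = ~~ odd (b * b) by [lia]; rewrite !oddM !andbb.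
  case: (boolP (odd a)) => oa;
    rewrite mem_filter mem_windmills !xpair_eqE !eqxx /= /f /= (mulnACA 2 2).
    have b2 : b = 2 * b./2 by lia.
    have b0 : 0 < b./2 by lia.
    rewrite -b2 abM eqxx b0.
    by split; [ | rewrite (_ : a - b + (b - a) = u) //; lia].
  have a2 : a = 2 * a./2 by lia.
  have a0 : 0 < a./2 by lia.
  rewrite -a2 addnC abM eqxx a0.
  by split; [ | rewrite (_ : b - a + (a - b) = u) //; lia].
- exact: windmills_uniq.
- by move=> [x [y z]]; rewrite !mem_windmills /= [z * y]mulnC => /and3P[-> -> ->].
- by move=> [x [y z]].
Qed.

(** On the line x + z = y one has M = (y + z)^2. If M = w^2, then z runs from 1 to (w - 1) / 2, an
    odd number of values exactly when w is 3 modulo 4. *)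
Lemma windmills_boundary M : M %% 4 = 1 ->
  odd (count (fun p => p.1 + p.2.2 == p.2.1) (windmills M)) = odd (nco3_div M).
Proof.
move=> M1; rewrite odd_nco3_div //; case: (is_squareP M) => [[w wM]|nsq]; last first.
  rewrite !count_none //.
    by move=> d _; apply/negP=> /andP[/eqP h _]; apply: nsq; exists d.
  move=> [x [y z]]; rewrite mem_windmills /= => /and3P[/eqP E _ _].
  by apply/eqP => xy; apply: nsq; exists (y + z); nia.
have w_odd : odd w by have : odd (w * w) by [lia]; rewrite oddM andbb.
have -> : count (fun d => (d * d == M) && (d %% 4 == 3)) (divisors M) = (w %% 4 == 3).
  rewrite (@eq_count _ _ (fun d => (w %% 4 == 3) && (d == w))); last first.
    move=> d /=; rewrite (_ : (d * d == M) = (d == w)); last by nia.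
    by case: eqP => [->|]; rewrite ?andbF ?andbT.
  case: eqP => _; last exact: count_pred0.
  by rewrite count_uniq_mem ?divisors_uniq // mem_divisors -?wM ?dvdn_mulr // wM; lia.
rewrite -size_filter.
rewrite (@size_bijection _ _ _ (iota 1 w./2) (fun p => p.2.2)
  (fun z => (w - 2 * z, (w - z, z)))).
- by rewrite size_iota; lia.
- exact: (filter_uniq _ (windmills_uniq M)).
- exact: iota_uniq.
- move=> [x [y z]]; rewrite mem_filter mem_windmills /=.
  case/and4P=> /eqP xy /eqP E y0 z0.
  have yzw : y + z = w by nia.
  have x0 : x != 0 by apply/eqP => x0; lia.
  rewrite mem_iota; split; first by lia.
  by congr (_, (_, _)); lia.
- move=> z; rewrite mem_iota => h; rewrite mem_filter mem_windmills /=; split=> //.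
  by apply/and4P; split; lia.
Qed.

(* An involution off the line [x + z = y], where [M = (y + z)^2]; the fixed
   points are the windmills with [x = y], i.e. the factorizations [M = x (x + 4 z)]. *)
Definition zagier (p : nat * (nat * nat)) : nat * (nat * nat) :=
  let: (x, (y, z)) := p in
  if x + z < y then (x + 2 * z, (z, y - x - z))
  else if x < 2 * y then (2 * y - x, (y, x + z - y))
  else (x - 2 * y, (x + z - y, y)).

Lemma windmills_zagier M : M %% 4 = 1 ->
  odd (count (fun p => p.1 + p.2.2 != p.2.1) (windmills M)) = odd (nsmall_div M).
Proof.
move=> M1; rewrite -size_filter (@odd_size_involution _ _ zagier); first last.
- move=> [x [y z]]; rewrite mem_filter mem_windmills /= => /and4P[/eqP b /eqP E y0 z0].
  (* Oddness of x excludes x = 2y, where the third branch would give 0. The first and third branches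
     invert each other, and the middle one inverts itself. *)
  have ox : odd x := odd_windmill M1 E.
  case: ltnP => h1 /=.
    rewrite (_ : x + 2 * z + (y - x - z) < z = false); last by lia.
    rewrite (_ : x + 2 * z < 2 * z = false); last by lia.
    by congr (_, (_, _)); lia.
  case: ltnP => h2 /=.
    rewrite (_ : 2 * y - x + (x + z - y) < y = false); last by lia.
    rewrite (_ : 2 * y - x < 2 * y); last by lia.
    by congr (_, (_, _)); lia.
  rewrite (_ : x - 2 * y + y < x + z - y); last by lia.
  by congr (_, (_, _)); lia.
- move=> [x [y z]]; rewrite mem_filter mem_windmills /= => /and4P[/eqP b /eqP E y0 z0].
  have ox : odd x := odd_windmill M1 E.
  case: ltnP => h1 /=; last case: ltnP => h2 /=;
    by rewrite mem_filter mem_windmills /=; apply/and4P; split; lia.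
- exact: (filter_uniq _ (windmills_uniq M)).
congr odd; rewrite -size_filter /nsmall_div -[RHS]size_filter.
(* A fixed point has x = y = d and M / d = d + 4z. *)
apply: (@size_bijection _ _ _ _ (fun p => p.1) (fun d => (d, (d, (M %/ d - d) %/ 4)))).
- exact: (filter_uniq _ (filter_uniq _ (windmills_uniq M))).
- by rewrite filter_uniq ?divisors_uniq.
- move=> [x [y z]]; rewrite 2!mem_filter mem_windmills /=.
  case/and5P=> /eqP fixp /eqP b /eqP E y0 z0.
  have xy : x = y.
    by move: fixp; case: ltnP => ?; [|case: ltnP => ?] => -[]; lia.
  rewrite -xy in E y0 *.
  have ME : x * (x + 4 * z) = M by nia.
  rewrite mem_filter mem_divisors; last by lia.
  have -> : M %/ x = x + 4 * z by rewrite -ME mulKn.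
  rewrite addKn mulKn //; split=> //.
  by rewrite -ME dvdn_mulr // andbT; nia.
- move=> d; rewrite [d \in _]mem_filter mem_divisors; last by lia.
  case/andP=> lt dM; split=> //.
  have M0 : 0 < M by lia.
  have [_ _ d0 E] := divisor_flip M0 dM.
  have lt' : d < M %/ d by rewrite -(ltn_pmul2l d0) E.
  set e := M %/ d in E lt' *.
  have mod4 : d %% 4 = e %% 4.
    have : (d * e) %% 4 = 1 by rewrite E.
    rewrite -modnMm; set a := d %% 4; set c := e %% 4.
    have : a < 4 by apply: ltn_pmod. have : c < 4 by apply: ltn_pmod.
    by case: a => [|[|[|[|]]]] //; case: c => [|[|[|[|]]]].
  set z := (e - d) %/ 4; have eE : e = d + 4 * z by lia.
  rewrite 2!mem_filter mem_windmills /=.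
  rewrite ltnNge leq_addr /= (_ : d < 2 * d); last by lia.
  apply/and5P; split; try lia.
  by apply/eqP; congr (_, (_, _)); lia.
Qed.

(** For M = 1 modulo 4, the two involutions give two expressions for the parity of the number of
    windmills. For M = 3 modulo 4, the right side is even, while 2M is 6 modulo 8 and so not a sum
    of two squares. *)
Lemma odd_nsq_pairs M : odd M -> odd (nsq_pairs M) = odd (nsmall_div M + nco3_div M).
Proof.
move=> oM; have [M1|M3] : M %% 4 = 1 \/ M %% 4 = 3 by lia.
  rewrite -windmills_swap // oddD -windmills_zagier // -windmills_boundary // -oddD.
  by rewrite addnC -count_predT (count_predC _ (windmills M)).
rewrite nco3_div_mod3 // oddD addbb /nsq_pairs count_none // => k.
rewrite mem_iota => kM; apply/negP => /andP[/is_squareP[u uE] /is_squareP[v vE]].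
have : (u * u + v * v) %% 8 = 6 by lia.
have sq8 x : (x * x) %% 8 = 0 \/ (x * x) %% 8 = 1 \/ (x * x) %% 8 = 4.
  rewrite -modnMm; have : x %% 8 < 8 by apply: ltn_pmod.
  by case: (x %% 8) => [|[|[|[|[|[|[|[|]]]]]]]] //=; auto.
by have := sq8 u; have := sq8 v; lia.
Qed.

(** * Reduction modulo 8 *)

Lemma sum_symmetric (F : nat -> nat -> nat) N : (forall a b, F a b = F b a) ->
  \sum_(b < N) \sum_(a < N) F a b =
  2 * (\sum_(b < N) \sum_(a < b) F a b) + \sum_(a < N) F a a.
Proof.
move=> symF; elim: N => [|N IH]; first by rewrite !big_ord0.
rewrite !big_ord_recr /=.
under eq_bigr => b _ do rewrite big_ord_recr /=.
have -> : \sum_(b < N) (\sum_(i < N) F i b + F N b) =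
    \sum_(b < N) \sum_(a < N) F a b + \sum_(i < N) F i N.
  by rewrite big_split; congr (_ + _); apply: eq_bigr => i _; apply: symF.
rewrite IH mulnDr.
set x := \sum_(i < N) F i N; set y := \sum_(i < N) F i i.
by set z := \sum_(i < N) \sum_(a < i) F a i; lia.
Qed.

Lemma sum_reflect (f : nat -> nat) m :
  \sum_(k < (2 * m).+1) f k * f (2 * m - k) =
  2 * (\sum_(k < m) f k * f (2 * m - k)) + f m * f m.
Proof.
pose G k := f k * f (2 * m - k).
rewrite -(big_mkord xpredT G) (@big_cat_nat _ _ _ m.+1) //=; last by lia.
rewrite big_nat_recr //= big_mkord /G (_ : 2 * m - m = m); last by lia.
rewrite [2 * \sum_(_ < _) _]mul2n -addnn addnAC; congr (_ + _ + _).
rewrite big_rev_mkord (_ : (2 * m).+1 - m.+1 = m); last by lia.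
apply: eq_bigr => k _; have := ltn_ord k => km.
by rewrite /G subSS subKn 1?mulnC //; lia.
Qed.

Lemma sum_over_divisors (F : nat -> nat) k N : 0 < k -> k < N ->
  \sum_(a < N) F a * (a %| k) = \sum_(a <- divisors k) F a.
Proof.
move=> k0 kN; rewrite -(big_mkord xpredT (fun a => F a * (a %| k))) /=.
rewrite (bigID (fun a => a %| k)) /= [X in _ + X]big1 ?addn0; last first.
  by move=> a /negbTE ->; rewrite muln0.
rewrite (eq_bigr F) => [|a ->]; last by rewrite muln1.
rewrite -big_filter; apply/perm_big/uniq_perm; rewrite ?filter_uniq ?iota_uniq ?divisors_uniq //.
move=> a; rewrite mem_filter mem_index_iota mem_divisors //=; apply: andb_idr => ak.
by have := dvdn_leq k0 ak; lia.
Qed.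

(** * Expansion by the number of distinct part sizes *)

Definition nrep a b n := \sum_(k < n.+1) pos_dvd b k * pos_dvd a (n - k).

Lemma nrep_sym a b n : nrep a b n = nrep b a n.
Proof.
rewrite /nrep (reindex_inj rev_ord_inj) /=; apply: eq_bigr => k _.
by rewrite subSS subKn 1?mulnC // -ltnS.
Qed.

(** When a divides n, this counts the compositions of n / a into two positive parts. *)
Lemma nrep_diag a n : 0 < a -> nrep a a n = pos_dvd a n * (n %/ a).-1.
Proof.
move=> a0; rewrite /nrep; case: (posnP n) => [->|n0].
  by rewrite big_ord_recl big_ord0.
rewrite {3}/pos_dvd n0 /=; case: (boolP (a %| n)) => [an|nan]; last first.
  rewrite big1 // => k _; rewrite /pos_dvd -mulnb.
  case: (boolP (a %| k)) => ak; rewrite ?andbF ?muln0 ?mul0n //.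
  by rewrite dvdn_subl 1?(negbTE nan) ?andbF ?muln0 // -ltnS.
rewrite mul1n divn_count_dvd big_nat_recr //= an addn1 /=.
case: n n0 an => // n _ an.
rewrite big_ord_recr /= subnn muln0 addn0 big_ord_recl /= mul0n add0n.
rewrite [in RHS]big_add1 big_mkord.
apply: eq_bigr => k _; rewrite /bump /= add1n subSS /pos_dvd /= subn_gt0 ltn_ord.
by rewrite -subSS dvdn_subr // ?ltnS 1?ltnW //; case: (a %| k.+1).
Qed.

Section Expand.

Variable A : pred nat.

(** These count partitions of [n] into allowed parts below [p] with exactly one size, respectively
    two sizes a < b, where [k] is the total of the copies of b. *)
Definition one_size p n := \sum_(a < p) A a * pos_dvd a n.
Definition two_sizes p n := \sum_(b < p) A b * \sum_(k < n.+1) pos_dvd b k * one_size b (n - k).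

(** Each factor (1 + q^a) / (1 - q^a) is 1 plus twice the sum of q^(ja) over j > 0, so r distinct
    sizes carry weight 2^r; [R] collects r >= 3. *)
Lemma count_below_expand p : exists R : nat -> nat,
  forall n, count_below A p n = (n == 0) + 2 * one_size p n + 4 * two_sizes p n + 8 * R n.
Proof.
elim: p => [|p [R RE]].
  by exists (fun=> 0) => n; rewrite /one_size /two_sizes !big_ord0 /=; lia.
(* Adding the size [p] doubles the weight: 4 becomes 8, and 8 becomes 16, whence the inner
   [2 * R]. *)
exists (fun n => R n + A p * \sum_(k < n.+1) pos_dvd p k * (two_sizes p (n - k) + 2 * R (n - k))) => n.
have N1S : one_size p.+1 n = one_size p n + A p * pos_dvd p n by rewrite /one_size big_ord_recr.
have N2S : two_sizes p.+1 n =
    two_sizes p n + A p * \sum_(k < n.+1) pos_dvd p k * one_size p (n - k).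
  by rewrite /two_sizes big_ord_recr.
rewrite N1S N2S [count_below _ _ _]/= RE.
have -> : \sum_(k < n.+1) pos_dvd p k * count_below A p (n - k) =
   pos_dvd p n + 2 * \sum_(k < n.+1) pos_dvd p k * one_size p (n - k)
   + 4 * \sum_(k < n.+1) pos_dvd p k * (two_sizes p (n - k) + 2 * R (n - k)).
  have -> : pos_dvd p n = \sum_(k < n.+1) pos_dvd p k * (n - k == 0).
    rewrite big_ord_recr /= subnn muln1 big1 // => k _.
    by rewrite (_ : (n - k == 0) = false) ?muln0 //; have := ltn_ord k; lia.
  rewrite !big_distrr -!big_split /=; apply: eq_bigr => k _; rewrite RE.
  by case: (pos_dvd p k) => [|d]; nia.
by case: (A p); lia.
Qed.

(** The convolution runs over ordered pairs of sizes: unequal sizes appear in both orders, and equal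
    sizes give the [nrep a a] terms. *)
Lemma two_sizes_convolution n :
  2 * two_sizes n.+1 n + \sum_(a < n.+1) A a * nrep a a n =
  \sum_(k < n.+1) one_size n.+1 k * one_size n.+1 (n - k).
Proof.
pose F a b := A a * A b * nrep a b n.
have symF a b : F a b = F b a by rewrite /F nrep_sym [A a * _]mulnC.
have -> : two_sizes n.+1 n = \sum_(b < n.+1) \sum_(a < b) F a b.
  apply: eq_bigr => b _; rewrite /one_size.
  under eq_bigr => k _ do rewrite big_distrr /=.
  rewrite exchange_big big_distrr /=; apply: eq_bigr => a _.
  rewrite /F /nrep !big_distrr /=; apply: eq_bigr => k _.
  by case: (A a); case: (A b); rewrite ?muln0 ?mul0n ?mul1n.
have -> : \sum_(a < n.+1) A a * nrep a a n = \sum_(a < n.+1) F a a.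
  by apply: eq_bigr => a _; rewrite /F mulnb andbb.
rewrite -sum_symmetric //; apply/esym.
under eq_bigr => k _ do rewrite /one_size big_distrl /=.
rewrite exchange_big; apply: eq_bigr => b _ /=.
under eq_bigr => k _ do rewrite big_distrr /=.
rewrite exchange_big; apply: eq_bigr => a _ /=.
rewrite /F /nrep big_distrr /=; apply: eq_bigr => k _.
by case: (A a); case: (A b); rewrite ?muln0 ?mul0n ?mul1n.
Qed.

End Expand.

(** * Divisors of multiples, and divisors not divisible by 3 *)

Section DivisorSums.

Variable F : nat -> nat.

Lemma divisors_mul_dvd p M : 0 < p -> 0 < M ->
  \sum_(a <- divisors (p * M) | p %| a) F a = \sum_(a <- divisors M) F (p * a).
Proof.
move=> p0 M0; rewrite -big_filter -(big_map (muln p) xpredT F).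
have pM0 : 0 < p * M by rewrite muln_gt0 p0.
apply/perm_big/uniq_perm.
- by rewrite filter_uniq ?divisors_uniq.
- rewrite map_inj_uniq ?divisors_uniq // => a b /eqP.
  by rewrite eqn_pmul2l // => /eqP.
move=> a; rewrite mem_filter mem_divisors //; apply/andP/mapP => [[/dvdnP[q ->]]|[q]].
  by rewrite mulnC dvdn_pmul2l // => qM; exists q; rewrite ?mem_divisors.
by rewrite mem_divisors // => qM ->; rewrite dvdn_mulr // dvdn_pmul2l.
Qed.

Lemma divisors_prime_ndvd p M : prime p -> ~~ (p %| M) -> 0 < M ->
  \sum_(a <- divisors (p * M) | ~~ (p %| a)) F a = \sum_(a <- divisors M) F a.
Proof.
move=> p_pr pM M0; rewrite -big_filter; have p0 := prime_gt0 p_pr.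
have pM0 : 0 < p * M by rewrite muln_gt0 p0.
apply/perm_big/uniq_perm; rewrite ?filter_uniq ?divisors_uniq //.
move=> a; rewrite mem_filter !mem_divisors //; apply/andP/idP => [[pa]|aM].
  by rewrite Gauss_dvdr // coprime_sym prime_coprime.
by rewrite dvdn_mull //; split=> //; apply: contra pM => /dvdn_trans; apply.
Qed.

End DivisorSums.

Definition tau3 k := count (fun a => ~~ (3 %| a)) (divisors k).

Lemma tau3_ndiv k : 0 < k -> tau3 k + (3 %| k) * ndiv (k %/ 3) = ndiv k.
Proof.
move=> k0; rewrite /ndiv -[RHS](count_predC (dvdn 3)) addnC; congr (_ + _).
case: (boolP (3 %| k)) => [/dvdnP[M kE]|k3]; last first.
  rewrite count_none // => a; rewrite mem_divisors // => ak; apply: contra k3 => /dvdn_trans.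
  exact.
rewrite mul1n {}kE in k0 *; rewrite mulnK // mulnC -sum1_count divisors_mul_dvd ?sum1_size //; lia.
Qed.

(** The divisors of m = 3M divisible by 3 are 3a with a dividing M, and their cofactors m / (3a) = M
    / a are those in M. *)
Lemma nco3_div_split m : 0 < m ->
  count (fun a => ~~ (3 %| a) && ((m %/ a) %% 4 == 3)) (divisors m)
    + (3 %| m) * nco3_div (m %/ 3) = nco3_div m.
Proof.
move=> m0; rewrite /nco3_div -!sum1_count [RHS](bigID (fun a => ~~ (3 %| a))) /=.
congr (_ + _); first by apply: eq_bigl => a; rewrite andbC.
under [RHS]eq_bigl => a do rewrite negbK andbC.
case: (boolP (3 %| m)) => [/dvdnP[M mE]|m3]; last first.
  rewrite mul0n sum1_count count_none // => a; rewrite mem_divisors // => am.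
  by rewrite negb_and; apply/orP; left; apply: contra m3 => /dvdn_trans; apply.
rewrite mul1n {}mE in m0 *; rewrite mulnK // mulnC big_mkcondr /= divisors_mul_dvd; try lia.
rewrite -big_mkcond; apply: eq_bigl => a.
by rewrite divnMl.
Qed.

(** The odd and the even divisors of 2k each correspond to the divisors of k, and doubling does not
    affect divisibility by 3. *)
Lemma tau3_double k : odd k -> tau3 (2 * k) = 2 * tau3 k.
Proof.
move=> ok; rewrite /tau3 -!sum1_count big_mkcond [LHS](bigID (dvdn 2)) /=.
have k0 : 0 < k by lia.
rewrite divisors_mul_dvd // divisors_prime_ndvd //; last by lia.
rewrite mul2n -addnn [in RHS]big_mkcond /=; congr (_ + _).
by apply: eq_bigr => a _; rewrite Euclid_dvdM.
Qed.

Lemma is_square_mod8 k : is_square k -> [\/ k %% 8 = 0, k %% 8 = 1 | k %% 8 = 4].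
Proof.
case/is_squareP=> x <-; rewrite -modnMm; have : x %% 8 < 8 by apply: ltn_pmod.
by case: (x %% 8) => [|[|[|[|[|[|[|[|]]]]]]]] //= _;
  [constructor 1|constructor 2|constructor 3|constructor 2|constructor 1
  |constructor 2|constructor 3|constructor 2].
Qed.

(** [tau3 k] is the number of divisors of k, less that of k / 3 when 3 divides k; a divisor count is
    odd exactly at squares. *)
Lemma odd_tau3 k : 0 < k -> odd (tau3 k) = is_square k (+) ((3 %| k) && is_square (k %/ 3)).
Proof.
move=> k0; have := tau3_ndiv k0; rewrite (ndiv_nsmall k0).
case: (boolP (3 %| k)) => /= k3; last by lia.
have k30 : 0 < k %/ 3 by lia.
rewrite (ndiv_nsmall k30) mul1n; set e := nsmall_div k; set e' := nsmall_div _.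
by case: (is_square k); case: (is_square (k %/ 3)); lia.
Qed.

Lemma nsq_pairs_sum M : nsq_pairs M = \sum_(k < M) (is_square k && is_square (2 * M - k)).
Proof.
rewrite -(big_mkord xpredT (fun k => (is_square k && is_square (2 * M - k) : nat))).
rewrite /nsq_pairs -sum1_count big_mkcond /index_iota subn0.
by apply: eq_bigr => k _; case: (_ && _).
Qed.

Lemma odd_sum_ord N (F G : 'I_N -> nat) : (forall i, odd (F i) = odd (G i)) ->
  odd (\sum_i F i) = odd (\sum_i G i).
Proof.
by move=> FG; rewrite !(big_morph odd oddD (erefl (odd 0))); apply: eq_bigr.
Qed.

(** * The count at twice an odd number, modulo 8 *)

Section Main.

Variable t : nat.
Hypothesis t_ge2 : 2 <= t.

Let A := regular_part 3 (2 ^ t).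

(** As t >= 2, a multiple of 2^t is a multiple of 4 and cannot divide k. *)
Lemma regular_part_mod4 a k : k %% 4 != 0 -> a %| k -> A a = ~~ (3 %| a).
Proof.
move=> k4 ak; rewrite /A /regular_part (_ : 2 ^ t %| a = false) ?andbT //.
apply/negP=> ta; move/negP: k4; apply; apply: dvdn_trans ak; apply: dvdn_trans ta.
by rewrite -(subnKC t_ge2) expnD dvdn_mulr.
Qed.

Lemma one_size_tau3 N k : k %% 4 != 0 -> k < N -> one_size A N k = tau3 k.
Proof.
move=> k4 kN; have k0 : 0 < k by case: (k) k4.
rewrite /one_size /pos_dvd k0 /= (sum_over_divisors (fun a => A a : nat) k0 kN).
rewrite /tau3 -sum1_count [RHS]big_mkcond.
rewrite big_seq [RHS]big_seq; apply: eq_bigr => a; rewrite mem_divisors // => ak.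
by rewrite (regular_part_mod4 k4 ak); case: (3 %| a).
Qed.

Variable m : nat.
Hypothesis m_odd : odd m.

Let tau := one_size A (2 * m).+1.

Definition sqpair k := is_square k && is_square (2 * m - k).
Definition sqpair3 k :=
  [&& 3 %| k, 3 %| 2 * m - k, is_square (k %/ 3) & is_square ((2 * m - k) %/ 3)].

Lemma odd_tau_tau k : k < m -> odd (tau k * tau (2 * m - k)) = sqpair k (+) sqpair3 k.
Proof.
move=> km; rewrite oddM.
case: (boolP (odd k)) => ok.
  rewrite /tau !one_size_tau3 ?odd_tau3; try lia.
  rewrite /sqpair /sqpair3; set l := 2 * m - k.
  have l_odd : odd l by lia.
  have kl4 : k %% 4 = l %% 4 by lia.
  (* For odd k, k and 2m - k agree modulo 4, while odd squares are 1 and their triples 3, so a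
     square never meets three times a square. *)
  have sq1 j : odd j -> is_square j -> j %% 4 = 1 by move=> oj /is_square_mod8[]; lia.
  have sq3 j : odd j -> 3 %| j -> is_square (j %/ 3) -> j %% 4 = 3.
    by move=> oj j3 /is_square_mod8[]; lia.
  have := sq1 k ok; have := sq3 k ok; have := sq1 l l_odd; have := sq3 l l_odd.
  case: (is_square k); case: (is_square l); case: (3 %| k); case: (3 %| l) => //=;
  case: (is_square (k %/ 3)); case: (is_square (l %/ 3)) => //= h1 h2 h3 h4;
  do ?have {}h1 := h1 isT; do ?have {}h2 := h2 isT; do ?have {}h3 := h3 isT;
  do ?have {}h4 := h4 isT; lia.
have nsq j : j %% 4 = 2 -> is_square j = false by move=> j2; apply/negP => /is_square_mod8[]; lia.
have nsq3 j : j %% 4 = 2 -> (3 %| j) && is_square (j %/ 3) = false.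
  by move=> j2; case: (boolP (3 %| j)) => //= j3; apply: nsq; lia.
have evtau j : j %% 4 = 2 -> j <= 2 * m -> odd (tau j) = false.
  move=> j2 jm; rewrite /tau one_size_tau3; try lia.
  by rewrite (_ : j = 2 * j./2) ?tau3_double ?oddM //; lia.
(* For even k, one of the two terms is 2 modulo 4. There tau is even, and the number is neither a
   square nor three times one, so both sides vanish. *)
have [k2|k2] : k %% 4 = 2 \/ (2 * m - k) %% 4 = 2 by lia.
  have := nsq3 _ k2; rewrite /sqpair /sqpair3 (nsq _ k2) (evtau _ k2); last by lia.
  by case: (3 %| k) => //= ->; rewrite andbF.
have := nsq3 _ k2; rewrite /sqpair /sqpair3 (nsq _ k2) (evtau _ k2) ?andbF; last by lia.
by case: (3 %| k) => //=; case: (3 %| _) => //= ->; rewrite andbF.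
Qed.

(** If k and 2m - k are both divisible by 3, so is m; then k = 3j turns the sum into the one for m /
    3. *)
Lemma sum_sqpair3 : \sum_(k < m) sqpair3 k = (3 %| m) * nsq_pairs (m %/ 3).
Proof.
case: (boolP (3 %| m)) => [/dvdnP[M mE]|m3]; last first.
  rewrite big1 // => k _; rewrite /sqpair3; case: (boolP (3 %| k)) => //= k3.
  by rewrite (_ : (3 %| _) = false) //; have := ltn_ord k; lia.
have G k : sqpair3 k = (3 %| k) && (is_square (k %/ 3) && is_square (2 * M - k %/ 3)) :> bool.
  rewrite /sqpair3; case: (boolP (3 %| k)) => //= k3.
  rewrite (_ : (2 * m - k) %/ 3 = 2 * M - k %/ 3); last by lia.
  by rewrite (_ : 3 %| 2 * m - k) //; lia.
under eq_bigr => k _ do rewrite G.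
rewrite mul1n mE mulnK // nsq_pairs_sum.
pose h j : nat := is_square j && is_square (2 * M - j).
have -> : \sum_(k < M * 3) ((3 %| k) && (is_square (k %/ 3) && is_square (2 * M - k %/ 3))) =
    \sum_(k < M * 3) (3 %| k) * h (k %/ 3).
  by apply: eq_bigr => k _; rewrite mulnb.
rewrite -[RHS]/(\sum_(k < M) h k).
elim: (M) => [|j IH]; first by rewrite !big_ord0.
rewrite mulSn addnC addn3 !big_ord_recr /= IH.
have [-> -> ->] : [/\ 3 %| j * 3, 3 %| (j * 3).+1 = false & 3 %| (j * 3).+2 = false].
  by split; lia.
by rewrite mulnK // mul1n !mul0n !addn0.
Qed.

Lemma odd_half_convolution : odd (\sum_(k < m) tau k * tau (2 * m - k)) =
  odd (nsq_pairs m + (3 %| m) * nsq_pairs (m %/ 3)).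
Proof.
rewrite nsq_pairs_sum -sum_sqpair3 -big_split; apply: odd_sum_ord => k /=.
by rewrite odd_tau_tau // oddD !oddb.
Qed.

Lemma diag_sum : exists X,
  \sum_(a < (2 * m).+1) A a * nrep a a (2 * m) =
  tau3 m + 6 * count (fun a => ~~ (3 %| a) && ((m %/ a) %% 4 == 3)) (divisors m) + 12 * X.
Proof.
exists (\sum_(a <- divisors m | ~~ (3 %| a)) (m %/ a) %/ 4).
have m0 : 0 < m by lia.
have m4 : (2 * m) %% 4 != 0 by lia.
have -> : \sum_(a < (2 * m).+1) A a * nrep a a (2 * m) =
    \sum_(a < (2 * m).+1) (A a * ((2 * m) %/ a).-1) * (a %| 2 * m).
  apply: eq_bigr => a _; case: (posnP a) => [->|a0].
    by rewrite /A /regular_part dvdn0 !mul0n.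
  by rewrite nrep_diag // /pos_dvd (_ : 0 < 2 * m) /= 1?mulnCA 1?mulnC; lia.
rewrite (sum_over_divisors (fun a => A a * ((2 * m) %/ a).-1)) //; last by lia.
rewrite (eq_big_seq (fun a => ~~ (3 %| a) * ((2 * m) %/ a).-1)); last first.
  by move=> a; rewrite mem_divisors; last by [lia]; move=> am; rewrite (regular_part_mod4 m4 am).
(* With e = m / a, the divisors 2a and a of 2m contribute (e - 1) + (2e - 1) = 3e - 2. Writing the
   odd e as 4q + 1 or 4q + 3 gives 1 + 12q or 7 + 12q; [X] sums the q. *)
rewrite (bigID (dvdn 2)) /= divisors_mul_dvd // divisors_prime_ndvd //; last by lia.
rewrite /tau3 -!sum1_count !big_distrr /= (big_mkcond (fun a => ~~ (3 %| a))).
rewrite (big_mkcond (fun a => ~~ (3 %| a) && _)) [X in _ = _ + X]big_mkcond.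
rewrite -!big_split /=; apply: eq_big_seq => a; rewrite mem_divisors // => am.
rewrite Euclid_dvdM //=; case: (3 %| a) => //=.
have [_ _ a0 E] := divisor_flip m0 am.
rewrite divnMl // !mul1n -muln_divA //; set e := m %/ a in E *.
have e_odd : odd e by move: m_odd; rewrite -E oddM => /andP[].
by case: eqP; lia.
Qed.

Lemma Bbar_double_odd : ~~ is_square m -> Bbar 3 (2 ^ t) (2 * m) = 0 %[mod 8].
Proof.
move=> m_nsq; have m0 : 0 < m by lia.
rewrite Bbar_count -/A; have [R ->] := count_below_expand A (2 * m).+1.
have -> : one_size A (2 * m).+1 (2 * m) = 2 * tau3 m.
  by rewrite one_size_tau3 ?tau3_double //; lia.
(* The count is 4 (T + N2) modulo 8 with T = [tau3 m], so T + N2 must be even. The convolution gives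
   N2 = S + T (T - 1) / 2 + A' modulo 2. *)
have := two_sizes_convolution A (2 * m); rewrite sum_reflect -/tau.
have -> : tau m = tau3 m by rewrite /tau one_size_tau3 //; lia.
have [X ->] := diag_sum.
have := odd_half_convolution; set S := \sum_(k < m) _; set Np := two_sizes _ _ _.
have := nco3_div_split m0; set A' := count _ _.
have := tau3_ndiv m0; rewrite (ndiv_nsmall m0) (negbTE m_nsq) addn0.
rewrite oddD (odd_nsq_pairs m_odd) oddM.
(* If 3 does not divide m, then T = 2e, A' = a and S = e + a modulo 2, so N2 is even. *)
case: (boolP (3 %| m)) => /= m3; last first.
  rewrite !addn0 => -> -> oS E; move: oS E; set e := nsmall_div m; set a := nco3_div m.
  by nia.
have M_odd : odd (m %/ 3) by lia.
have M0 : 0 < m %/ 3 by lia.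
rewrite (odd_nsq_pairs M_odd) (ndiv_nsmall M0) !mul1n.
set e := nsmall_div m; set a := nco3_div m; set e' := nsmall_div _; set a' := nco3_div _.
set T := tau3 m.
(* Here A' = a - a' and S = e + a + e' + a' modulo 2. T is odd exactly when m / 3 is a square;
   writing T as 2h + 1 or 2h shows that N2 has the parity of T. *)
case: (is_square _) => /= TE AE oS E.
  have [h hE] : exists h, T = 2 * h + 1 by exists (e - e').-1; lia.
  have : T * T = 4 * (h * h) + 4 * h + 1 by rewrite hE; lia.
  lia.
have [h hE] : exists h, T = 2 * h by exists (e - e'); lia.
have : T * T = 4 * (h * h) by rewrite hE; lia.
lia.
Qed.

End Main.

Theorem theorem9p1 (t : nat) (ht : 2 <= t) (n : nat) :
  [/\ Bbar 3 (2 ^ t) (16 * n + 6) = 0 %[mod 8],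
      Bbar 3 (2 ^ t) (16 * n + 10) = 0 %[mod 8]
    & Bbar 3 (2 ^ t) (16 * n + 14) = 0 %[mod 8]].
Proof.
have key r : r %% 8 \in [:: 3; 5; 7] -> Bbar 3 (2 ^ t) (2 * r) = 0 %[mod 8].
  rewrite !inE => hr; apply: Bbar_double_odd => //; first by lia.
  by apply/negP => /is_square_mod8[]; lia.
split.
- by rewrite (_ : _ + _ = 2 * (8 * n + 3)) ?key // ?inE; lia.
- by rewrite (_ : _ + _ = 2 * (8 * n + 5)) ?key // ?inE; lia.
- by rewrite (_ : _ + _ = 2 * (8 * n + 7)) ?key // ?inE; lia.
Qed.
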